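(* Let $m\ge 2$, let $p_1,\dots,p_m$ be the $p$-values (random variables with values in $[0,1]$, with arbitrary joint dependence) computed for $m$ null hypotheses $H_{01},\dots,H_{0m}$, let $I_0\subseteq\{1,\dots,m\}$ be the set of indices of the true null hypotheses, and let $\mathbb{P}(p_i\le u)\le u$ for all $i\in I_0$ and $u\in[0,1]$. Let $\alpha>0$, let $1\le s_1\le s_2\le\dots\le s_m\le m$ be a non-decreasing shape sequence, and let non-negative weights $w_1,\dots,w_m$ be given. Let $\nu$ be a probability distribution on $(0,\infty)$ and define the reshaping function $\xi(r)=\int_{(0,r]}u\,d\nu(u)$ for $r>0$. Then the step-up procedure with threshold sequence $t_r=\xi(s_r)\alpha/m$ $(r=1,\dots,m)$ applied to $q_1,\dots,q_m$, where $q_i=p_i/w_i$ if $w_i>0$ and $q_i=1$ if $w_i=0$, satisfies $$\mathrm{pFDR}=\mathbb{E}\left[\frac{\mathit{FP}}{s_R}\,\mathbf{1}\{R>0\}\right]\le \frac{\alpha}{m}\sum_{i=1}^m w_i .$$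
   Context: Let $q_{(1)}\le\dots\le q_{(m)}$ be the ordered values of $q_1,\dots,q_m$. The step-up procedure with non-decreasing threshold sequence $t_1\le\dots\le t_m$ applied to $q_1,\dots,q_m$ is defined by $R=\max\{r\in\{1,\dots,m\}: q_{(r)}\le t_r\}$, with $R=0$ if no such $r$ exists; it rejects no hypothesis if $R=0$, and if $R\ge1$ it rejects exactly the hypotheses $H_{0i}$ with $q_i\le t_R$ (there are exactly $R$ of them). $R$ is the number of rejections and $\mathit{FP}$ denotes the number of rejected hypotheses with index in $I_0$ (false positives). The penalized false discovery proportion is $\mathit{pFDP}=\mathit{FP}/s_R$ if $R\ge1$ and $0$ otherwise (the denominator is $s_R$, not $\xi(s_R)$), and the penalized false discovery rate is $\mathrm{pFDR}=\mathbb{E}(\mathit{pFDP})$. The weights are deterministic (fixed a priori).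
   Formalization: Added assumption: if some true null hypothesis has weight w_i = 0, then t_m < 1 (automatic when α < 1). Without it the bound fails, e.g. m = 2, both nulls true, w = (0,0), s = (1,1), α = 2, ν the point mass at 1. *)

(* Defs.v *)
From mathcomp Require Import all_boot all_order all_algebra.
From mathcomp Require Import all_classical all_reals all_analysis.

Set Implicit Arguments.
Unset Strict Implicit.
Unset Printing Implicit Defensive.

Import Order.TTheory GRing.Theory Num.Theory.
Import numFieldNormedType.Exports.

Local Open Scope classical_set_scope.
Local Open Scope ring_scope.

(* Sequences indexed by the rank r = 1, ..., m (shape sequence, thresholds) are
   functions on nat of which only the values at 1, ..., m are used; families
   indexed by the hypotheses are functions on 'I_m. *)

Section StepUp.
Context {R : realType} {m : nat}.
Implicit Types (q : 'I_m -> R) (t : nat -> R) (I : {set 'I_m}).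

(* The r-th smallest value q_(r), for 1 <= r <= m. *)
Definition order_stat q (r : nat) : R :=
  nth 0 (sort <=%R [seq q i | i <- enum 'I_m]) r.-1.

Definition num_rejections t q : nat :=
  (\max_(r < m.+1 | (0 < r)%N && (order_stat q r <= t r)%R) r)%N.

Definition rejected t q : {set 'I_m} :=
  if num_rejections t q == 0%N then finset.set0
  else [set i | q i <= t (num_rejections t q)]%SET.

Definition false_positives t I q : nat := #|(rejected t q :&: I)%SET|.

Definition pFDP (s : nat -> R) t I q : R :=
  if num_rejections t q == 0%N then 0
  else (false_positives t I q)%:R / s (num_rejections t q).

End StepUp.

(* The integral is finite, since 0 < u <= r on the domain. *)
Definition reshaping {R : realType} (nu : probability (measurableTypeR R) R)
  (r : R) : R := \int[nu]_(u in `]0, r]) u.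

Definition reshaped_threshold {R : realType} (m : nat) (alpha : R)
  (nu : probability (measurableTypeR R) R) (s : nat -> R) (r : nat) : R :=
  reshaping nu (s r) * alpha / m%:R.

Definition weighted_pvalue {R : realType} {m : nat} (w p : 'I_m -> R)
  (i : 'I_m) : R := if 0 < w i then p i / w i else 1.

Definition pFDR {d : measure_display} {T : measurableType d} {R : realType}
  (P : probability T R) {m : nat} (s t : nat -> R) (I0 : {set 'I_m})
  (q : T -> 'I_m -> R) : \bar R := 'E_P[fun x => pFDP s t I0 (q x)].

(* Main.v *)
Require Import Defs.
From mathcomp Require Import all_boot all_order all_algebra.
From mathcomp Require Import all_classical all_reals all_analysis.
From mathcomp Require Import ring lra.

Import Order.TTheory GRing.Theory Num.Theory.
Import numFieldNormedType.Exports.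
Local Open Scope classical_set_scope.
Local Open Scope ring_scope.

(** The only probabilistic input is one bound per true null, in the spirit of
    Blanchard and Roquain. Since FP counts the true nulls i with q_i <= t_R,
    linearity reduces the claim to E[1{p_i <= c_i xi(s_R), R > 0} / s_R] <= c_i
    with c_i = (alpha / m) w_i, where nothing is known on the joint law of p_i
    and R. The events A_r = {p_i <= c_i xi(s_r)} increase with r. Writing 1/s_R
    as the telescoping sum of d_r = 1/s_r - 1/s_(r+1) over R <= r <= m (with
    1/s_(m+1) read as 0), the integrand is at most sum_r d_r 1_(A_r), an
    expression from which R has disappeared ([inv_shape_le_envelope]).
    Superuniformity bounds its expectation by c_i sum_r d_r xi(s_r)
    ([integral_shape_envelope_le]).

    It remains that sum_r d_r xi(s_r) <= 1 ([sum_inv_shape_reshaping_le1]).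
    By summation by parts the sum equals that of
    (xi(s_r) - xi(s_(r-1))) / s_r, and each increment of xi is the integral of
    u over ]s_(r-1), s_r], hence at most s_r nu(]s_(r-1), s_r]). The total is
    then at most nu(]0, s_m]) <= 1.

    The domination is pointwise, so that neither the number of rejections nor
    the false discovery proportion has to be shown measurable: for nonnegative
    functions the integral is monotone without measurability
    ([le_integral_nonmeasurable]). *)

(** * Integration preliminaries *)

(** The integral of a nonnegative function is the supremum of the integrals of
    the simple functions below it, and a larger function has more of them. *)
Lemma le_integral_nonmeasurable (d : measure_display) (T : measurableType d)
    (R : realType) (mu : {measure set T -> \bar R}) (f g : T -> \bar R) :
  (forall x, 0 <= f x)%E -> (forall x, f x <= g x)%E ->
  (\int[mu]_x f x <= \int[mu]_x g x)%E.
Proof.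
move=> f0 fg.
have g0 x : (0 <= g x)%E by exact: le_trans (f0 x) (fg x).
rewrite !ge0_integralTE//.
apply: ereal_sup_le => _ [h hf <-]; exists h => // x.
exact: le_trans (hf x) (fg x).
Qed.

Lemma measurable_sublevel (d : measure_display) (T : measurableType d)
    (R : realType) (P : probability T R) (U : {RV P >-> R}) (u : R) :
  measurable [set x | U x <= u].
Proof.
have -> : [set x | U x <= u] = U @^-1` `]-oo, u]%classic.
  by apply/seteqP; split => x /=; rewrite in_itv.
by rewrite -[_ @^-1` _]setTI; exact: measurable_funP.
Qed.

Lemma integrable_scaled_indic (d : measure_display) (T : measurableType d)
    (R : realType) (P : probability T R) (k : R) (A : set T) : measurable A ->
  P.-integrable setT (fun x => k%:E * (\1_A x)%:E)%E.
Proof. by move=> mA; apply: integrableZl => //; exact: integrable_indic. Qed.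

(** * Increments of the reshaping function *)

Section Reshaping.
Context {R : realType} (nu : probability (measurableTypeR R) R).

Lemma integrable_id_itvoc (b : R) :
  nu.-integrable `]0, b]%classic (EFin \o (fun u : R => u)).
Proof.
apply: measurable_bounded_integrable => //.
- exact: le_lt_trans (probability_le1 nu _) (ltry 1).
- exists `|b|; split; first exact: num_real.
  move=> M bM u /=; rewrite in_itv/= => /andP[u0 ub].
  by rewrite ger0_norm ?(ltW u0)// (le_trans ub)// (le_trans (ler_norm b))// ltW.
Qed.

Lemma reshaping0 : reshaping nu 0 = 0.
Proof. by rewrite /reshaping set_itv_ge ?Rintegral_set0// bnd_simp ltxx. Qed.

Lemma itvoc_split (a b : R) : 0 <= a -> a <= b ->
  `]0, b]%classic = `]0, a]%classic `|` `]a, b]%classic :> set R.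
Proof. by move=> a0 ab; rewrite -itv_bndbnd_setU// bnd_simp. Qed.

Lemma itvoc_disjoint (a b : R) :
  `]0, a]%classic `&` `]a, b]%classic = set0 :> set R.
Proof.
rewrite -subset0 => u [] /=; rewrite !in_itv/= => /andP[_ ua] /andP[au _].
by move: (lt_le_trans au ua); rewrite ltxx.
Qed.

Lemma reshapingB (a b : R) : 0 <= a -> a <= b ->
  reshaping nu b - reshaping nu a = \int[nu]_(u in `]a, b]) u.
Proof.
move=> a0 ab; rewrite /reshaping (itvoc_split _ _ a0 ab).
rewrite Rintegral_setU//; first by rewrite addrC addKr.
- by rewrite -itvoc_split//; exact: integrable_id_itvoc.
- by rewrite disj_set2E itvoc_disjoint.
Qed.

Lemma le_reshaping (a b : R) : 0 <= a -> a <= b ->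
  reshaping nu a <= reshaping nu b.
Proof.
move=> a0 ab; rewrite -subr_ge0 reshapingB//.
apply: Rintegral_ge0 => u /=; rewrite in_itv/= => /andP[au _].
exact: le_trans a0 (ltW au).
Qed.

Lemma reshaping_ge0 (b : R) : 0 <= reshaping nu b.
Proof.
by apply: Rintegral_ge0 => u /=; rewrite in_itv/= => /andP[/ltW].
Qed.

(** The integrand u is at most b on ]a, b]. This trades increments of xi for
    increments of mass, which is where the definition of xi enters. *)
Lemma reshapingB_le (a b : R) : 0 <= a -> a <= b ->
  reshaping nu b - reshaping nu a <=
  b * (fine (nu `]0, b]%classic) - fine (nu `]0, a]%classic)).
Proof.
move=> a0 ab.
have -> : fine (nu `]0, b]%classic) - fine (nu `]0, a]%classic) =
          fine (nu `]a, b]%classic).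
  rewrite (itvoc_split _ _ a0 ab) measureU//; last exact: itvoc_disjoint.
  by rewrite fineD ?fin_num_measure// addrC addKr.
have mab : measurable (`]a, b]%classic : set (measurableTypeR R)) by [].
rewrite reshapingB// -(Rintegral_cst nu mab).
apply: le_Rintegral => //.
- apply: integrableS (integrable_id_itvoc b) => //.
  by apply: subset_itvr; rewrite bnd_simp.
- exact: finite_measure_integrable_cst.
- by move=> u /=; rewrite in_itv/= => /andP[_].
Qed.

End Reshaping.

(** * Telescoping the inverse shape sequence *)

(** Summation by parts turns the left-hand side into the sum of
    v (k+1) (x (k+1) - x k) over k < n, which is compared term by term with the
    telescoping sum of the increments of F. Keeping the boundary term makes the
    inequality inductive; it vanishes in the application, where
    v (n+1) = 0. *)
Lemma abel_sum_le (R : realType) (v x F : nat -> R) (n : nat) :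
  x 0%N = 0 -> F 0%N = 0 ->
  (forall k, (k < n)%N -> v k.+1 * (x k.+1 - x k) <= F k.+1 - F k) ->
  \sum_(1 <= r < n.+1) (v r - v r.+1) * x r + v n.+1 * x n <= F n.
Proof.
move=> x0 F0; elim: n => [|n IHn] incr.
  by rewrite big_geq// x0 F0 mulr0 addr0.
rewrite big_nat_recr//=.
have := IHn (fun k kn => incr k (ltnW kn)); have := incr n (ltnSn n).
lra.
Qed.

(** The cut-off beyond m lets 1 / s_m be the last difference of the sequence,
    so that the terms of a telescoping sum ending at m are uniform. *)
Definition inv_shape {R : realType} (m : nat) (s : nat -> R) (r : nat) : R :=
  if (r <= m)%N then (s r)^-1 else 0.

(** A bound for 1{U <= c xi_k} / s_k that depends on no rank k. When the events
    U <= c xi_r increase with r, it is 1 / s_r for the first r <= m at which the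
    event holds, and 0 if there is none. *)
Definition shape_envelope {R : realType} {T : Type} (m : nat)
    (s xi : nat -> R) (c : R) (U : T -> R) (x : T) : R :=
  \sum_(1 <= r < m.+1) (inv_shape m s r - inv_shape m s r.+1) *
    \1_[set y | U y <= c * xi r] x.

Section Shape.
Context {R : realType} (m : nat) (s : nat -> R).
Hypothesis hs1 : 1 <= s 1%N.
Hypothesis hs : forall r r' : nat, (1 <= r)%N -> (r <= r')%N -> (r' <= m)%N ->
  s r <= s r'.

Lemma shape_gt0 r : (1 <= r <= m)%N -> 0 < s r.
Proof.
move=> /andP[r1 rm]; apply: lt_le_trans ltr01 _.
exact: le_trans hs1 (hs 1%N r (leqnn 1) r1 rm).
Qed.

Lemma inv_shape_decr r : (1 <= r)%N -> inv_shape m s r.+1 <= inv_shape m s r.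
Proof.
move=> r1; rewrite /inv_shape; case: (ltnP r m) => rm.
  by rewrite (ltnW rm) lef_pV2 ?posrE ?shape_gt0 ?r1 ?(ltnW rm)// hs.
by case: ifP => // rm'; rewrite invr_ge0 ltW// shape_gt0 ?r1.
Qed.

(** Setting s_0 = 0, the sum is at most that of nu(]s_(r-1), s_r]), by
    summation by parts and [reshapingB_le]. *)
Lemma sum_inv_shape_reshaping_le1 (nu : probability (measurableTypeR R) R) :
  \sum_(1 <= r < m.+1) (inv_shape m s r - inv_shape m s r.+1) *
    reshaping nu (s r) <= 1.
Proof.
(* Summation by parts starts from rank 0, where [s] is unconstrained; the value 0
   there makes both xi and the mass of ]0, s0 0] vanish. *)
pose s0 r := if r is 0%N then 0 else s r.
have s0_ge0 k : (k <= m)%N -> 0 <= s0 k.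
  by case: k => //= k km; rewrite ltW ?shape_gt0.
have s0_le k : (k < m)%N -> s0 k <= s0 k.+1.
  by case: k => [|k] km /=; [rewrite ltW ?shape_gt0 | rewrite hs].
have := @abel_sum_le R (inv_shape m s) (fun r => reshaping nu (s0 r))
  (fun r => fine (nu `]0, s0 r]%classic)) m (reshaping0 nu).
have -> : inv_shape m s m.+1 = 0 by rewrite /inv_shape ltnn.
rewrite mul0r addr0 => abel.
have -> : \sum_(1 <= r < m.+1) (inv_shape m s r - inv_shape m s r.+1) *
    reshaping nu (s r) = \sum_(1 <= r < m.+1)
    (inv_shape m s r - inv_shape m s r.+1) * reshaping nu (s0 r).
  by apply: eq_big_nat => -[].
apply: (@le_trans _ _ (fine (nu `]0, s0 m]%classic))); first apply: abel.
- by rewrite set_itv_ge ?measure0// bnd_simp ltxx.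
- move=> k km; rewrite /inv_shape km ler_pdivrMl ?shape_gt0//.
  exact: reshapingB_le nu _ _ (s0_ge0 _ (ltnW km)) (s0_le _ km).
- by rewrite -lee_fin fineK ?fin_num_measure// probability_le1.
Qed.

Section Envelope.
Context {T : Type} (xi : nat -> R) (c : R) (U : T -> R).

Lemma shape_envelope_ge0 x : 0 <= shape_envelope m s xi c U x.
Proof.
rewrite /shape_envelope big_nat_cond; apply: sumr_ge0 => r.
rewrite andbT => /andP[r1 _].
by rewrite mulr_ge0// subr_ge0 inv_shape_decr.
Qed.

(** The terms of rank at least k already telescope to 1 / s_k, since the events
    increase from rank k on; the earlier ones are nonnegative. *)
Lemma inv_shape_le_envelope k x : 0 <= c ->
  (forall r, (k <= r <= m)%N -> xi k <= xi r) ->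
  (1 <= k <= m)%N -> U x <= c * xi k ->
  (s k)^-1 <= shape_envelope m s xi c U x.
Proof.
move=> c0 xik /andP[k1 km] Ux.
have -> : (s k)^-1 =
    \sum_(k <= r < m.+1) (inv_shape m s r - inv_shape m s r.+1).
  under eq_bigr do rewrite -opprB.
  rewrite sumrN telescope_sumr ?leqW// opprB.
  by rewrite /inv_shape km ltnn subr0.
rewrite /shape_envelope [leRHS](big_cat_nat (n := k))//=; last exact: leqW.
rewrite -[leLHS]add0r lerD//.
- rewrite big_nat_cond; apply: sumr_ge0 => r; rewrite andbT => /andP[r1 _].
  by rewrite mulr_ge0// subr_ge0 inv_shape_decr.
- rewrite [leLHS](_ : _ = \sum_(k <= r < m.+1)
    (inv_shape m s r - inv_shape m s r.+1) * \1_[set y | U y <= c * xi r] x) //.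
  apply: eq_big_nat => r kr; rewrite indicE mem_set ?mulr1//=.
  by apply: le_trans Ux _; rewrite ler_wpM2l// xik.
Qed.

End Envelope.

Lemma integrable_shape_envelope (d : measure_display) (T : measurableType d)
    (P : probability T R) (xi : nat -> R) (c : R) (U : {RV P >-> R}) :
  P.-integrable setT (EFin \o shape_envelope m s xi c U).
Proof.
rewrite (_ : EFin \o _ = fun x => (\sum_(r <- index_iota 1 m.+1)
    ((inv_shape m s r - inv_shape m s r.+1)%:E *
     (\1_[set y | (U y <= c * xi r)%R] x)%:E))%E); last first.
  by apply/funext => x /=; rewrite -sumEFin.
apply: integrable_sum => [|r _]; first exact: measurableT.
by apply: integrable_scaled_indic; exact: measurable_sublevel.
Qed.

(** The thresholds c xi(s_r) are deterministic in each term, so superuniformity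
    of U applies to them separately whatever the dependence structure. *)
Lemma integral_shape_envelope_le (d : measure_display) (T : measurableType d)
    (P : probability T R) (nu : probability (measurableTypeR R) R) (c : R)
    (U : {RV P >-> R}) :
  0 <= c ->
  (forall u : R, 0 <= u <= 1 -> (P [set x | (U x <= u)%R] <= u%:E)%E) ->
  (\int[P]_x (shape_envelope m s (fun r => reshaping nu (s r)) c U x)%:E
    <= c%:E)%E.
Proof.
move=> c0 hU.
have mA u : measurable [set x | U x <= u] by exact: measurable_sublevel.
(* Thresholds may exceed 1, where superuniformity holds because P <= 1. *)
have PA u : 0 <= u -> (P [set x | (U x <= u)%R] <= u%:E)%E.
  move=> u0; have [u1|/ltW u1] := leP u 1; first by rewrite hU// u0.
  by apply: le_trans (probability_le1 P (mA u)) _; rewrite lee_fin.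
pose D r := inv_shape m s r - inv_shape m s r.+1.
pose A r := [set y | U y <= c * reshaping nu (s r)].
have iA r : P.-integrable setT (fun x => (D r)%:E * (\1_(A r) x)%:E)%E.
  by apply: integrable_scaled_indic; exact: mA.
rewrite (eq_integral (fun x => \sum_(r <- index_iota 1 m.+1)
    ((D r)%:E * (\1_(A r) x)%:E))%E); last first.
  by move=> x _; rewrite -sumEFin.
rewrite integral_sum//.
apply: (@le_trans _ _ (\sum_(r <- index_iota 1 m.+1)
    (D r * (c * reshaping nu (s r)))%:E)%E).
  rewrite big_nat_cond [leRHS]big_nat_cond.
  apply: lee_sum => r; rewrite andbT => /andP[r1 _].
  rewrite integralZl//; last by apply: integrable_indic; exact: mA.
  rewrite integral_indic//; last exact: mA.
  rewrite setIT EFinM lee_wpmul2l ?lee_fin ?subr_ge0 ?inv_shape_decr//.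
  by apply: PA; rewrite mulr_ge0// reshaping_ge0.
rewrite sumEFin lee_fin.
under eq_bigr do rewrite mulrCA.
by rewrite -mulr_sumr ler_piMr// sum_inv_shape_reshaping_le1.
Qed.

End Shape.

(** * The step-up procedure *)

Lemma num_rejections_le (R : realType) (m : nat) (t : nat -> R)
    (q : 'I_m -> R) : (num_rejections t q <= m)%N.
Proof. by apply/bigmax_leqP => i _; rewrite -ltnS. Qed.

Theorem proposition4p3 (d : measure_display) (T : measurableType d)
  (R : realType) (P : probability T R) (m : nat) (hm : (2 <= m)%N)
  (p : 'I_m -> {RV P >-> R})
  (hp : forall (i : 'I_m) (x : T), 0 <= p i x <= 1)
  (I0 : {set 'I_m})
  (hnull : forall (i : 'I_m) (u : R), i \in I0 -> 0 <= u <= 1 ->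
     (P [set x | (p i x <= u)%R]%classic <= u%:E)%E)
  (alpha : R) (halpha : 0 < alpha)
  (s : nat -> R)
  (hs1 : 1 <= s 1%N)
  (hs : forall r r' : nat, (1 <= r)%N -> (r <= r')%N -> (r' <= m)%N ->
     s r <= s r')
  (hsm : s m <= m%:R)
  (w : 'I_m -> R) (hw : forall i : 'I_m, 0 <= w i)
  (nu : probability (measurableTypeR R) R) (hnu : nu `]0%R, +oo[%classic = 1%E)
  (* Guards the convention q_i = 1 for zero weights: such a hypothesis must not
     be rejectable. Vacuous if all weights are positive, automatic if
     alpha < 1; without it the bound fails (all weights zero, t_m >= 1). *)
  (hw0 : forall i : 'I_m, i \in I0 -> w i = 0 ->
     reshaped_threshold m alpha nu s m < 1) :
  (pFDR P s (reshaped_threshold m alpha nu s) I0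
     (fun x => weighted_pvalue w (fun i => p i x))
   <= (alpha / m%:R * \sum_(i < m) w i)%:E)%E.
Proof.
have m0 : 0 < m%:R :> R by rewrite ltr0n ltnW.
pose xi r := reshaping nu (s r).
pose c i := alpha / m%:R * w i.
have c0 i : 0 <= c i by rewrite mulr_ge0// divr_ge0// ltW.
have xi_le k r : (1 <= k)%N -> (k <= r <= m)%N -> xi k <= xi r.
  move=> k1 /andP[kr rm]; apply: le_reshaping; last exact: hs.
  by apply/ltW/(shape_gt0 _ _ hs1 hs); rewrite k1 (leq_trans kr).
pose env i := shape_envelope m s xi (c i) (p i).
have env0 i x : 0 <= env i x by exact: (shape_envelope_ge0 _ _ hs1 hs).
(* True nulls of zero weight are left out: they are never rejected, and they
   contribute nothing to the right-hand side. *)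
pose J := [set i in I0 | 0 < w i]%SET.
rewrite /pFDR unlock.
apply: (@le_trans _ _ (\int[P]_x (\sum_(i in J) env i x)%:E)%E).
  apply: le_integral_nonmeasurable => x; rewrite lee_fin /pFDP.
    case: eqP => // /eqP R0; rewrite divr_ge0// ltW// (shape_gt0 _ _ hs1 hs)//.
    by rewrite lt0n R0 num_rejections_le.
  set q := weighted_pvalue _ _; rewrite /false_positives /rejected.
  set r := num_rejections _ q; case: eqP => [_|/eqP R0]; first exact: sumr_ge0.
  have rm : (1 <= r <= m)%N by rewrite lt0n R0 num_rejections_le.
  set K := finset.setI _ I0.
  rewrite -sum1_card natr_sum mulr_suml.
  have KJ i : i \in K -> i \in J /\ p i x <= c i * xi r.
    rewrite !finset.inE /q /weighted_pvalue => /andP[qi iI0].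
    rewrite iI0 /=; move: qi; case: ifPn => [wi|].
      rewrite ler_pdivrMr// => pi; split=> //; apply: le_trans pi _.
      rewrite (_ : _ * w i = c i * xi r) //.
      by rewrite /reshaped_threshold /c /xi; ring.
    (* With zero weight q_i = 1 > t_m >= t_R, so i cannot be in K. *)
    rewrite lt_neqAle hw andbT negbK => /eqP/esym wi t1; exfalso.
    have := hw0 i iI0 wi; rewrite ltNge => /negP; apply.
    apply: le_trans t1 _; rewrite /reshaped_threshold ler_pM2r ?invr_gt0//.
    rewrite ler_pM2r//; apply: xi_le; first by case/andP: rm.
    by case/andP: rm => _ ->; rewrite leqnn.
  apply: (@le_trans _ _ (\sum_(i in K) env i x)).
    apply: ler_sum => i /KJ[_ pi]; rewrite mul1r.
    apply: (inv_shape_le_envelope _ _ hs1 hs) => // k rk.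
    by apply: xi_le => //; case/andP: rm.
  rewrite [leRHS](bigID (mem K))/= -[leLHS]addr0 lerD ?sumr_ge0//.
  rewrite (eq_bigl (fun i => (i \in J) && (i \in K))) // => i.
  by case iK: (i \in K); rewrite ?andbF// (KJ _ iK).1.
under eq_integral do rewrite -sumEFin.
rewrite integral_sum//; last by move=> i; exact: integrable_shape_envelope.
apply: (@le_trans _ _ (\sum_(i in J) (c i)%:E)%E).
  apply: lee_sum => i; rewrite finset.inE => /andP[iI0 _].
  apply: (integral_shape_envelope_le _ _ hs1 hs) => // u.
  exact: hnull.
rewrite sumEFin lee_fin mulr_sumr [leRHS](bigID (mem J))/=.
by rewrite -[leLHS]addr0 lerD ?sumr_ge0// => i _; exact: c0.
Qed.
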